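(* Let $\mathbb{X}$ be a Cartesian tangent category with a curve object $(C,c_1,c_0)$. Suppose that $V_1,V_2$ are complete vector fields on an object $M$ with associated flows $\gamma_1,\gamma_2:C\times M\to M$. If $V_1$ and $V_2$ commute, then their sum $\langle V_1,V_2\rangle +:M\to TM$ is also a complete vector field, with flow $$C\times M\xrightarrow{\Delta\times 1}C\times C\times M\xrightarrow{1\times\gamma_1}C\times M\xrightarrow{\gamma_2}M,$$ where $\Delta=\langle 1,1\rangle:C\to C\times C$ is the diagonal.
   Context: Composition is written in diagrammatic order: $fg$ means first $f$, then $g$. A tangent category is a category $\mathbb{X}$ with a functor $T:\mathbb{X}\to\mathbb{X}$ and natural transformations $p:T\to 1$, $0:1\to T$, $+:T_2\to T$, $\ell:T\to T^2$, $c:T^2\to T^2$ such that: (1) for all $M,n$ the fibre power $T_nM$ of $n$ copies of $p_M:TM\to M$ exists and is preserved by every $T^k$; (2) $(p_M,+_M,0_M)$ is an additive bundle, i.e. a commutative monoid in $\mathbb{X}/M$; (3) $(\ell_M,0_M)$ is an additive bundle morphism (commuting square preserving addition and zero) from $(p_M,+_M,0_M)$ to $(T(p_M),T(+_M),T(0_M))$, and $(c_M,1_{TM})$ is one from $(T(p_M),T(+_M),T(0_M))$ to $(p_{TM},+_{TM},0_{TM})$; (4) $cc=1$, $\ell c=\ell$, $\ell T(\ell)=\ell\ell_T$, $T(c)c_TT(c)=c_TT(c)c_T$, $\ell_TT(c)c_T=cT(\ell)$; (5) with $v:=\langle\pi_0\ell,\pi_10_{TM}\rangle T(+):T_2M\to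 T^2M$, the square $vT(p)=\pi_0p0$ exhibits $T_2M$ as the pullback of $T(p_M)$ along $0_M$, and this pullback is preserved by every $T^k$. It is Cartesian if it has finite products (terminal object $1$, unique maps to it written $!$) and $T$ preserves them; $T(A\times B)$ is identified with $TA\times TB$. Object subscripts are often omitted. A vector field on $M$ is a map $V:M\to TM$ with $Vp=1_M$; $\langle V_1,V_2\rangle:M\to T_2M$ is the pairing into the fibre power. A dynamical system $(M,V,g)$ is a vector field $V$ on $M$ with a map $g:1\to M$. Given a fixed dynamical system $(C,c_1,c_0)$: a parameterized dynamical system (or system) $(M,V,g)$ is a vector field $V:M\to TM$ with a map $g:X\to M$; a solution of it is a map $\gamma:C\times X\to M$ with $\langle !c_0,1\rangle\gamma=g$ and $(c_1\times 0)T(\gamma)=\gamma V$. A curve object is a dynamical system $(C,c_1,c_0)$ such that: (Preinitial) every parameterized dynamical system has at most one solution; (Commutativity of $c_1$) $c_1T(c_1)c=c_1T(c_1)$; (Completeness of $c_1$) the system $(C,c_1,1_C)$ has a solution. A vector field $V$ on $M$ is complete if every system $(M,V,g)$ has a solution (equivalently, $(M,V,1_M)$ has a solution); the flow associated to a complete $V$ is the unique solution of $(M,V,1_M)$. Vector fields $V_1,V_2$ on $M$ commute if $V_1T(V_2)c=V_2T(V_1)$. *)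

(* Defs.v *)
From mathcomp Require Import ssreflect ssrfun ssrbool eqtype ssrnat fintype.

Set Implicit Arguments.
Unset Strict Implicit.
Unset Printing Implicit Defensive.

Declare Scope cat_scope.
Delimit Scope cat_scope with cat.

(** Categories, functors, natural transformations.  Composition [f ;; g] is in
    diagrammatic order: first [f], then [g]. *)

Record category := Category {
  obj :> Type;
  hom : obj -> obj -> Type;
  idm : forall A, hom A A;
  cmp : forall A B C, hom A B -> hom B C -> hom A C;
  cmp_idl : forall A B (f : hom A B), cmp (idm A) f = f;
  cmp_idr : forall A B (f : hom A B), cmp f (idm B) = f;
  cmpA : forall A B C D (f : hom A B) (g : hom B C) (h : hom C D),
    cmp f (cmp g h) = cmp (cmp f g) h }.

Arguments idm {c} A.

Notation "A ~> B" := (hom A B) (at level 60, no associativity) : cat_scope.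
Notation "f ;; g" := (cmp f g) (at level 50, left associativity) : cat_scope.
Local Open Scope cat_scope.

Record functor (X Y : category) := Functor {
  fobj :> X -> Y;
  fmap : forall A B, A ~> B -> fobj A ~> fobj B;
  fmap_id : forall A, fmap (idm A) = idm (fobj A);
  fmap_cmp : forall A B C (f : A ~> B) (g : B ~> C),
    fmap (f ;; g) = fmap f ;; fmap g }.

Arguments fmap {X Y} F {A B} f : rename.

Definition idF (X : category) : functor X X :=
  @Functor X X (fun A => A) (fun A B f => f)
    (fun A => erefl) (fun A B C f g => erefl).

Lemma compF_id (X Y Z : category) (F : functor X Y) (G : functor Y Z) (A : X) :
  fmap G (fmap F (idm A)) = idm (G (F A)).
Proof. by rewrite !fmap_id. Qed.

Lemma compF_cmp (X Y Z : category) (F : functor X Y) (G : functor Y Z)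
    (A B C : X) (f : A ~> B) (g : B ~> C) :
  fmap G (fmap F (f ;; g)) = fmap G (fmap F f) ;; fmap G (fmap F g).
Proof. by rewrite !fmap_cmp. Qed.

Definition compF (X Y Z : category) (F : functor X Y) (G : functor Y Z) :
    functor X Z :=
  @Functor X Z (fun A => G (F A)) (fun A B f => fmap G (fmap F f))
    (compF_id F G) (@compF_cmp X Y Z F G).

Fixpoint iterF (X : category) (T : functor X X) (k : nat) : functor X X :=
  if k is k'.+1 then compF (iterF T k') T else idF X.

Record nat_trans (X Y : category) (F G : functor X Y) := NatTrans {
  nt_app :> forall A, F A ~> G A;
  nt_nat : forall A B (f : A ~> B), fmap F f ;; nt_app B = nt_app A ;; fmap G f }.

(** Fibre powers: the product of [n] copies of [p : E ~> B] in the slice over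
    [B].  The map [q] to the base is part of the cone, so that the case
    [n = 0] is the terminal object of the slice. *)

Record fibre_power (X : category) (E B : X) (p : E ~> B) (n : nat) (P : X)
    (q : P ~> B) (pr : 'I_n -> P ~> E) : Type := FibrePower {
  fp_over : forall i, pr i ;; p = q;
  fp_lift : forall (Z : X) (b : Z ~> B) (f : 'I_n -> Z ~> E),
    (forall i, f i ;; p = b) -> Z ~> P;
  fp_lift_base : forall (Z : X) (b : Z ~> B) (f : 'I_n -> Z ~> E)
    (fb : forall i, f i ;; p = b), fp_lift fb ;; q = b;
  fp_lift_proj : forall (Z : X) (b : Z ~> B) (f : 'I_n -> Z ~> E)
    (fb : forall i, f i ;; p = b) (i : 'I_n), fp_lift fb ;; pr i = f i;
  fp_uniq : forall (Z : X) (h k : Z ~> P),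
    h ;; q = k ;; q -> (forall i, h ;; pr i = k ;; pr i) -> h = k }.

Definition i0_2 : 'I_2 := @Ordinal 2 0 isT.
Definition i1_2 : 'I_2 := @Ordinal 2 1 isT.
Definition i0_3 : 'I_3 := @Ordinal 3 0 isT.
Definition i1_3 : 'I_3 := @Ordinal 3 1 isT.
Definition i2_3 : 'I_3 := @Ordinal 3 2 isT.

Definition fam2 (A : Type) (a b : A) (i : 'I_2) : A :=
  if i == i0_2 then a else b.

Lemma fam2_over (X : category) (E B Z : X) (p : E ~> B) (f g : Z ~> E)
    (fg : f ;; p = g ;; p) (i : 'I_2) : fam2 f g i ;; p = f ;; p.
Proof. by rewrite /fam2; case: ifP. Qed.

Lemma fp_same (X : category) (E B : X) (p : E ~> B) (n : nat) (P : X)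
    (q : P ~> B) (pr : 'I_n -> P ~> E) (H : fibre_power p q pr) (i j : 'I_n) :
  pr i ;; p = pr j ;; p.
Proof. by rewrite !(fp_over H). Qed.

Definition fp_pair (X : category) (E B : X) (p : E ~> B) (P : X)
    (q : P ~> B) (pr : 'I_2 -> P ~> E) (H : fibre_power p q pr) (Z : X)
    (f g : Z ~> E) (fg : f ;; p = g ;; p) : Z ~> P :=
  fp_lift H (fam2_over fg).

Lemma fp_pair0 (X : category) (E B : X) (p : E ~> B) (P : X)
    (q : P ~> B) (pr : 'I_2 -> P ~> E) (H : fibre_power p q pr) (Z : X)
    (f g : Z ~> E) (fg : f ;; p = g ;; p) : fp_pair H fg ;; pr i0_2 = f.
Proof. exact: fp_lift_proj. Qed.

Lemma fp_pair1 (X : category) (E B : X) (p : E ~> B) (P : X)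
    (q : P ~> B) (pr : 'I_2 -> P ~> E) (H : fibre_power p q pr) (Z : X)
    (f g : Z ~> E) (fg : f ;; p = g ;; p) : fp_pair H fg ;; pr i1_2 = g.
Proof. exact: fp_lift_proj. Qed.

Lemma fp_pair_base (X : category) (E B : X) (p : E ~> B) (P : X)
    (q : P ~> B) (pr : 'I_2 -> P ~> E) (H : fibre_power p q pr) (Z : X)
    (f g : Z ~> E) (fg : f ;; p = g ;; p) : fp_pair H fg ;; q = f ;; p.
Proof. exact: fp_lift_base. Qed.

Record is_pullback (X : category) (A B D P : X) (f : A ~> D) (g : B ~> D)
    (a : P ~> A) (b : P ~> B) : Prop := IsPullback {
  pb_comm : a ;; f = b ;; g;
  pb_univ : forall (Z : X) (x : Z ~> A) (y : Z ~> B), x ;; f = y ;; g ->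
    exists! h : Z ~> P, h ;; a = x /\ h ;; b = y }.

(** A [prebundle] carries the operations of a monoid in the slice over [base];
    [is_additive_bundle] is the commutative monoid axioms. *)

Record prebundle (X : category) := Prebundle {
  b_tot : X;
  b_base : X;
  b_proj : b_tot ~> b_base;
  b_pow : nat -> X;
  b_powq : forall n, b_pow n ~> b_base;
  b_pr : forall n, 'I_n -> b_pow n ~> b_tot;
  b_powP : forall n, fibre_power b_proj (b_powq n) (@b_pr n);
  b_add : b_pow 2 ~> b_tot;
  b_zero : b_base ~> b_tot;
  b_add_over : b_add ;; b_proj = b_powq 2;
  b_zero_over : b_zero ;; b_proj = idm b_base }.

Definition b_sum (X : category) (b : prebundle X) (Z : X)
    (f g : Z ~> b_tot b) (fg : f ;; b_proj b = g ;; b_proj b) : Z ~> b_tot b :=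
  fp_pair (b_powP b 2) fg ;; b_add b.

Lemma b_sum_over (X : category) (b : prebundle X) (Z : X)
    (f g : Z ~> b_tot b) (fg : f ;; b_proj b = g ;; b_proj b) :
  b_sum fg ;; b_proj b = f ;; b_proj b.
Proof.
by rewrite /b_sum -cmpA b_add_over fp_pair_base.
Qed.

Lemma b_zero_compat (X : category) (b : prebundle X) :
  (b_proj b ;; b_zero b) ;; b_proj b = idm (b_tot b) ;; b_proj b.
Proof. by rewrite -cmpA b_zero_over cmp_idr cmp_idl. Qed.

Definition b_same (X : category) (b : prebundle X) (n : nat) (i j : 'I_n) :
    b_pr b i ;; b_proj b = b_pr b j ;; b_proj b :=
  fp_same (b_powP b n) i j.

Record is_additive_bundle (X : category) (b : prebundle X) : Prop :=
  IsAdditiveBundle {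
  ab_assoc :
    let s01 := b_sum (b_same b i0_3 i1_3) in
    let s12 := b_sum (b_same b i1_3 i2_3) in
    let c01_2 : s01 ;; b_proj b = b_pr b i2_3 ;; b_proj b :=
      etrans (b_sum_over (b_same b i0_3 i1_3)) (b_same b i0_3 i2_3) in
    let c0_12 : b_pr b i0_3 ;; b_proj b = s12 ;; b_proj b :=
      etrans (b_same b i0_3 i1_3)
             (esym (b_sum_over (b_same b i1_3 i2_3))) in
    b_sum c01_2 = b_sum c0_12;
  ab_comm : b_sum (b_same b i1_2 i0_2) = b_add b;
  ab_unit : b_sum (b_zero_compat b) = idm (b_tot b) }.

Lemma bm_compat (X : category) (b b' : prebundle X)
    (f : b_tot b ~> b_tot b') (g : b_base b ~> b_base b')
    (fg : f ;; b_proj b' = b_proj b ;; g) (n : nat) (i j : 'I_n) :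
  (b_pr b i ;; f) ;; b_proj b' = (b_pr b j ;; f) ;; b_proj b'.
Proof. by rewrite -!cmpA fg !cmpA (b_same b i j). Qed.

Record is_additive_bundle_morphism (X : category) (b b' : prebundle X)
    (f : b_tot b ~> b_tot b') (g : b_base b ~> b_base b') : Prop :=
  IsAdditiveBundleMorphism {
  bm_sq : f ;; b_proj b' = b_proj b ;; g;
  bm_add : b_add b ;; f = b_sum (bm_compat bm_sq i0_2 i1_2);
  bm_zero : b_zero b ;; f = g ;; b_zero b' }.

Section ImageBundle.
Context (X : category) (F : functor X X) (b : prebundle X).

Lemma image_add_over : fmap F (b_add b) ;; fmap F (b_proj b) = fmap F (b_powq b 2).
Proof. by rewrite -fmap_cmp b_add_over. Qed.

Lemma image_zero_over : fmap F (b_zero b) ;; fmap F (b_proj b) = idm (F (b_base b)).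
Proof. by rewrite -fmap_cmp b_zero_over fmap_id. Qed.

Definition image_prebundle
    (pres : forall n, fibre_power (fmap F (b_proj b)) (fmap F (b_powq b n))
                        (fun i : 'I_n => fmap F (b_pr b i))) : prebundle X :=
  Prebundle pres image_add_over image_zero_over.

End ImageBundle.

(** Tangent structures.  The first layer has [T], [p] and the fibre powers
    [T_n M], whose universal property is preserved by every [T^k]; the case
    [k = 0] says that they are fibre powers. *)

Record tangent_powers (X : category) := TangentPowers {
  tT : functor X X;
  tp : nat_trans tT (idF X);
  tn : nat -> X -> X;
  tn_base : forall n M, tn n M ~> M;
  tn_pr : forall n M, 'I_n -> tn n M ~> tT M;
  tn_fp : forall k n M,
    fibre_power (fmap (iterF tT k) (tp M)) (fmap (iterF tT k) (tn_base n M))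
                (fun i : 'I_n => fmap (iterF tT k) (tn_pr M i)) }.

Arguments tn_base {X t} n M.
Arguments tn_pr {X t n} M i.

Section PowerFunctor.
Context (X : category) (t : tangent_powers X).

Definition tn_fp0 n M : fibre_power (tp t M) (tn_base n M) (@tn_pr X t n M) :=
  tn_fp t 0 n M.

Definition tn_fp1 n M :
    fibre_power (fmap (tT t) (tp t M)) (fmap (tT t) (tn_base n M))
                (fun i : 'I_n => fmap (tT t) (tn_pr M i)) :=
  tn_fp t 1 n M.

Lemma tn_map_over n A B (f : A ~> B) (i : 'I_n) :
  (tn_pr A i ;; fmap (tT t) f) ;; tp t B = tn_base n A ;; f.
Proof. by rewrite -cmpA nt_nat cmpA (fp_over (tn_fp0 n A)). Qed.

Definition tn_map n A B (f : A ~> B) : tn t n A ~> tn t n B :=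
  fp_lift (tn_fp0 n B) (tn_map_over f).

Lemma tn_map_id n A : tn_map n (idm A) = idm (tn t n A).
Proof.
apply: (fp_uniq (tn_fp0 n A)) => [|i].
  by rewrite fp_lift_base cmp_idl cmp_idr.
by rewrite fp_lift_proj fmap_id cmp_idl cmp_idr.
Qed.

Lemma tn_map_cmp n A B C (f : A ~> B) (g : B ~> C) :
  tn_map n (f ;; g) = tn_map n f ;; tn_map n g.
Proof.
apply: (fp_uniq (tn_fp0 n C)) => [|i].
  by rewrite -cmpA !fp_lift_base !cmpA fp_lift_base.
by rewrite -cmpA !fp_lift_proj !cmpA fp_lift_proj fmap_cmp cmpA.
Qed.

Definition tnF n : functor X X := Functor (tn_map_id n) (@tn_map_cmp n).

End PowerFunctor.

(** The equations [add_over] and [zero_over] say that [+] and [0] are maps in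
    the slices over [M]; they are the part of the additive bundle axiom needed
    to form the other axioms. *)

Record tangent_data (X : category) := TangentData {
  td_pow :> tangent_powers X;
  td_zero : nat_trans (idF X) (tT td_pow);
  td_add : nat_trans (tnF td_pow 2) (tT td_pow);
  td_lift : nat_trans (tT td_pow) (compF (tT td_pow) (tT td_pow));
  td_flip : nat_trans (compF (tT td_pow) (tT td_pow))
                      (compF (tT td_pow) (tT td_pow));
  td_add_over : forall M, td_add M ;; tp td_pow M = tn_base 2 M;
  td_zero_over : forall M, td_zero M ;; tp td_pow M = idm M }.

Section TangentAxioms.
Context (X : category) (t : tangent_data X).
Local Notation T := (tT t).
Local Notation p := (tp t).
Local Notation zero := (td_zero t).
Local Notation add := (td_add t).
Local Notation ell := (td_lift t).
Local Notation c := (td_flip t).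

Definition tbundle (M : X) : prebundle X :=
  Prebundle (fun n => tn_fp0 t n M) (td_add_over t M) (td_zero_over t M).

Definition Tbundle (M : X) : prebundle X :=
  @image_prebundle X T (tbundle M) (fun n => tn_fp1 t n M).

Record tangent_axioms : Prop := TangentAxioms {
  tx_bundle : forall M, is_additive_bundle (tbundle M);
  tx_lift : forall M,
    @is_additive_bundle_morphism X (tbundle M) (Tbundle M) (ell M) (zero M);
  tx_flip : forall M,
    @is_additive_bundle_morphism X (Tbundle M) (tbundle (T M))
      (c M) (idm (T M));
  tx_flip_flip : forall M, c M ;; c M = idm (T (T M));
  tx_lift_flip : forall M, ell M ;; c M = ell M;
  tx_lift_lift : forall M, ell M ;; fmap T (ell M) = ell M ;; ell (T M);
  tx_yang_baxter : forall M,
    fmap T (c M) ;; c (T M) ;; fmap T (c M)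
    = c (T M) ;; fmap T (c M) ;; c (T M);
  tx_lift_flip_flip : forall M,
    ell (T M) ;; fmap T (c M) ;; c (T M) = c M ;; fmap T (ell M) }.

Lemma vlift_compat (ax : tangent_axioms) (M : X) :
  (tn_pr M i0_2 ;; ell M) ;; fmap T (p M)
  = (tn_pr M i1_2 ;; zero (T M)) ;; fmap T (p M).
Proof.
rewrite -!cmpA (bm_sq (tx_lift ax M)) -(nt_nat zero (p M)) /= !cmpA.
by rewrite (fp_same (tn_fp0 t 2 M) i0_2 i1_2).
Qed.

(* The map v = <pi_0 ell, pi_1 0_T> T(+) : T_2 M -> T^2 M. *)
Definition vlift (ax : tangent_axioms) (M : X) : tn t 2 M ~> T (T M) :=
  fp_pair (tn_fp1 t 2 M) (vlift_compat ax M) ;; fmap T (add M).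

Definition vlift_universal (ax : tangent_axioms) : Prop :=
  forall (k : nat) (M : X),
    is_pullback (fmap (iterF T k) (fmap T (p M))) (fmap (iterF T k) (zero M))
      (fmap (iterF T k) (vlift ax M))
      (fmap (iterF T k) (tn_pr M i0_2 ;; p M)).

End TangentAxioms.

Record tangent_category := TangentCategory {
  tc_cat :> category;
  tc_data : tangent_data tc_cat;
  tc_axioms : tangent_axioms tc_data;
  tc_universal : vlift_universal tc_axioms }.

Record terminal (X : category) (I : X) : Type := Terminal {
  tm_map : forall Z, Z ~> I;
  tm_uniq : forall Z (f g : Z ~> I), f = g }.

Record product (X : category) (A B P : X) (p0 : P ~> A) (p1 : P ~> B) : Type :=
  Product {
  pr_pair : forall Z, Z ~> A -> Z ~> B -> Z ~> P;
  pr_pair0 : forall Z (f : Z ~> A) (g : Z ~> B), pr_pair f g ;; p0 = f;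
  pr_pair1 : forall Z (f : Z ~> A) (g : Z ~> B), pr_pair f g ;; p1 = g;
  pr_uniq : forall Z (h k : Z ~> P),
    h ;; p0 = k ;; p0 -> h ;; p1 = k ;; p1 -> h = k }.

Record cartesian_tangent_category := CartesianTangentCategory {
  ct_tan :> tangent_category;
  ct_one : ct_tan;
  ct_oneP : terminal ct_one;
  ct_prod : ct_tan -> ct_tan -> ct_tan;
  ct_fst : forall A B, ct_prod A B ~> A;
  ct_snd : forall A B, ct_prod A B ~> B;
  ct_prodP : forall A B, product (ct_fst A B) (ct_snd A B);
  ct_T_one : terminal (tT (tc_data ct_tan) ct_one);
  ct_T_prod : forall A B,
    product (fmap (tT (tc_data ct_tan)) (ct_fst A B))
            (fmap (tT (tc_data ct_tan)) (ct_snd A B)) }.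

Section CartesianOps.
Context {X : cartesian_tangent_category}.

Definition tan : functor X X := tT (tc_data X).
Definition tanp (M : X) : tan M ~> M := tp (tc_data X) M.
Definition tan0 (M : X) : M ~> tan M := td_zero (tc_data X) M.
Definition tanc (M : X) : tan (tan M) ~> tan (tan M) := td_flip (tc_data X) M.

Definition bang (A : X) : A ~> ct_one X := tm_map (ct_oneP X) A.
Definition pair (Z A B : X) (f : Z ~> A) (g : Z ~> B) : Z ~> ct_prod A B :=
  pr_pair (ct_prodP A B) f g.
Definition pmap (A A' B B' : X) (f : A ~> A') (g : B ~> B') :
    ct_prod A B ~> ct_prod A' B' :=
  pair (ct_fst A B ;; f) (ct_snd A B ;; g).
Definition passoc (A B C : X) :
    ct_prod (ct_prod A B) C ~> ct_prod A (ct_prod B C) :=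
  pair (ct_fst _ _ ;; ct_fst _ _) (pmap (ct_snd A B) (idm C)).
Definition diag (A : X) : A ~> ct_prod A A := pair (idm A) (idm A).

(* The canonical isomorphism identifying TA x TB with T(A x B); it is the
   inverse of the comparison map <T(pi_0), T(pi_1)>. *)
Definition tan_prod (A B : X) :
    ct_prod (tan A) (tan B) ~> tan (ct_prod A B) :=
  pr_pair (ct_T_prod A B) (ct_fst _ _) (ct_snd _ _).

End CartesianOps.

Arguments tan X : clear implicits.

Record vector_field (X : cartesian_tangent_category) (M : X) := VectorField {
  vf_map :> M ~> tan X M;
  vf_section : vf_map ;; tanp M = idm M }.

Record dynamical_system (X : cartesian_tangent_category) := DynamicalSystem {
  ds_obj : X;
  ds_vf : vector_field ds_obj;
  ds_init : ct_one X ~> ds_obj }.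

(* gamma solves the parameterized system (M, V, g). *)
Definition is_solution (X : cartesian_tangent_category)
    (C : dynamical_system X) (M : X) (V : vector_field M) (A : X) (g : A ~> M)
    (gamma : ct_prod (ds_obj C) A ~> M) : Prop :=
  pair (bang A ;; ds_init C) (idm A) ;; gamma = g /\
  pmap (ds_vf C) (tan0 A) ;; tan_prod (ds_obj C) A ;; fmap (tan X) gamma
    = gamma ;; V.

Definition commute (X : cartesian_tangent_category) (M : X)
    (V1 V2 : M ~> tan X M) : Prop :=
  V1 ;; fmap (tan X) V2 ;; tanc M = V2 ;; fmap (tan X) V1.

Record curve_object (X : cartesian_tangent_category)
    (C : dynamical_system X) : Prop := CurveObject {
  co_preinitial : forall (M : X) (V : vector_field M) (A : X) (g : A ~> M)
    (gamma gamma' : ct_prod (ds_obj C) A ~> M),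
    is_solution V g gamma -> is_solution V g gamma' -> gamma = gamma';
  co_commute : commute (ds_vf C) (ds_vf C);
  co_complete : exists gamma : ct_prod (ds_obj C) (ds_obj C) ~> ds_obj C,
    is_solution (ds_vf C) (idm (ds_obj C)) gamma }.

Definition complete (X : cartesian_tangent_category)
    (C : dynamical_system X) (M : X) (V : vector_field M) : Prop :=
  forall (A : X) (g : A ~> M),
    exists gamma : ct_prod (ds_obj C) A ~> M, is_solution V g gamma.

Definition is_flow (X : cartesian_tangent_category)
    (C : dynamical_system X) (M : X) (V : vector_field M)
    (gamma : ct_prod (ds_obj C) M ~> M) : Prop :=
  unique (@is_solution X C M V M (idm M)) gamma.

Lemma vf_compat (X : cartesian_tangent_category) (M : X)
    (V1 V2 : vector_field M) :
  V1 ;; tp (tc_data X) M = V2 ;; tp (tc_data X) M.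
Proof. exact: etrans (vf_section V1) (esym (vf_section V2)). Qed.

(* The map <V1, V2> + : M -> TM. *)
Definition vf_sum (X : cartesian_tangent_category) (M : X)
    (V1 V2 : vector_field M) : M ~> tan X M :=
  fp_pair (tn_fp0 (tc_data X) 2 M) (vf_compat V1 V2) ;; td_add (tc_data X) M.

(* Main.v *)
Require Import Defs.
From mathcomp Require Import ssreflect ssrfun ssrbool.

Set Implicit Arguments.
Unset Strict Implicit.
Unset Printing Implicit Defensive.

Local Open Scope cat_scope.

(** Let [gamma = <pi_0, gamma1> gamma2 : C x M -> M], that is, flow for time
    [s] along [V1] and then for time [s] along [V2].  Its initial value is the
    identity, and by functoriality of [T] its derivative in [s] is
    [<pi_0 c1, gamma1 V1> T(gamma2)].  In [T(C x M)] a pair [<a, b>] is the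
    sum of [<0, b>] and [<a, 0>] ([tpair_split]), and [T(gamma2)] preserves
    sums ([tsum_fmap]), so the derivative is the sum of [<0, gamma1 V1> T(gamma2)] and
    [<pi_0 c1, gamma1 0> T(gamma2)].  The second summand is [gamma V2] because
    [gamma2] solves [V2].  The first is [gamma V1] because the flow of [V2]
    preserves [V1] ([flow_preserves_commuting]): [gamma2 V1] and
    [(0 x V1) T(gamma2)] both solve the system [(TM, T(V2)c, V1)], the former
    by commutation of [V1] and [V2], the latter because [c] exchanges
    [T(0)] and [0_T]; and solutions are unique.  Thus [gamma] solves the system
    of the sum with initial value [1_M], and substitution in the parameter
    yields a solution for any other initial value. *)

(** * Pairing into products *)

Lemma pr_pair_cmp (X : category) (A B P : X) (p0 : P ~> A) (p1 : P ~> B)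
    (H : product p0 p1) (Y Z : X) (h : Y ~> Z) (f : Z ~> A) (g : Z ~> B) :
  h ;; pr_pair H f g = pr_pair H (h ;; f) (h ;; g).
Proof.
by apply: (pr_uniq H); rewrite -cmpA ?pr_pair0 ?pr_pair1.
Qed.

Section Pairing.
Context (X : cartesian_tangent_category).
Local Notation T := (tan X).

Lemma pair_fst (Z A B : X) (f : Z ~> A) (g : Z ~> B) :
  pair f g ;; ct_fst A B = f.
Proof. exact: pr_pair0. Qed.

Lemma pair_snd (Z A B : X) (f : Z ~> A) (g : Z ~> B) :
  pair f g ;; ct_snd A B = g.
Proof. exact: pr_pair1. Qed.

Lemma pair_cmp (Y Z A B : X) (h : Y ~> Z) (f : Z ~> A) (g : Z ~> B) :
  h ;; pair f g = pair (h ;; f) (h ;; g).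
Proof. exact: pr_pair_cmp. Qed.

Lemma pair_eta (A B : X) : pair (ct_fst A B) (ct_snd A B) = idm _.
Proof.
by apply: (pr_uniq (ct_prodP A B)); rewrite cmp_idl ?pair_fst ?pair_snd.
Qed.

Lemma pair_pmap (Z A A' B B' : X) (a : Z ~> A) (b : Z ~> B)
    (f : A ~> A') (g : B ~> B') :
  pair a b ;; pmap f g = pair (a ;; f) (b ;; g).
Proof. by rewrite pair_cmp !cmpA pair_fst pair_snd. Qed.

Lemma bang_cmp (A B : X) (f : A ~> B) : f ;; bang B = bang A.
Proof. exact: (tm_uniq (ct_oneP X)). Qed.

(** The map [<a, b>] into [T(A x B)], under the identification of
    [T(A x B)] with [TA x TB]. *)
Definition tpair (Z A B : X) (a : Z ~> T A) (b : Z ~> T B) :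
  Z ~> T (ct_prod A B) := pr_pair (ct_T_prod A B) a b.

Lemma tpair_fst (Z A B : X) (a : Z ~> T A) (b : Z ~> T B) :
  tpair a b ;; fmap T (ct_fst A B) = a.
Proof. exact: pr_pair0. Qed.

Lemma tpair_snd (Z A B : X) (a : Z ~> T A) (b : Z ~> T B) :
  tpair a b ;; fmap T (ct_snd A B) = b.
Proof. exact: pr_pair1. Qed.

Lemma tpair_cmp (Y Z A B : X) (h : Y ~> Z) (a : Z ~> T A) (b : Z ~> T B) :
  h ;; tpair a b = tpair (h ;; a) (h ;; b).
Proof. exact: pr_pair_cmp. Qed.

Lemma tpair_uniq (Z A B : X) (h k : Z ~> T (ct_prod A B)) :
  h ;; fmap T (ct_fst A B) = k ;; fmap T (ct_fst A B) ->
  h ;; fmap T (ct_snd A B) = k ;; fmap T (ct_snd A B) -> h = k.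
Proof. exact: (pr_uniq (ct_T_prod A B)). Qed.

Lemma cmp_fmap_pair (Z Y A B : X) (h : Z ~> T Y) (f : Y ~> A) (g : Y ~> B) :
  h ;; fmap T (pair f g) = tpair (h ;; fmap T f) (h ;; fmap T g).
Proof.
apply: tpair_uniq.
  by rewrite tpair_fst -cmpA -fmap_cmp pair_fst.
by rewrite tpair_snd -cmpA -fmap_cmp pair_snd.
Qed.

Lemma pmap_tan_prod (A A' B B' : X) (f : A ~> T A') (g : B ~> T B') :
  pmap f g ;; tan_prod A' B' =
  tpair (ct_fst A B ;; f) (ct_snd A B ;; g).
Proof. by rewrite pr_pair_cmp pair_fst pair_snd. Qed.

(** [T^2] preserves products: joint monicity of the projections. *)
Lemma tan2_prod_uniq (Z A B : X) (h k : Z ~> T (T (ct_prod A B))) :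
  h ;; fmap T (fmap T (ct_fst A B)) = k ;; fmap T (fmap T (ct_fst A B)) ->
  h ;; fmap T (fmap T (ct_snd A B)) = k ;; fmap T (fmap T (ct_snd A B)) ->
  h = k.
Proof.
move=> hk0 hk1.
(* The comparison map T(A x B) -> TA x TB is a split monomorphism. *)
have retr : pair (fmap T (ct_fst A B)) (fmap T (ct_snd A B)) ;; tan_prod A B
            = idm _.
  apply: tpair_uniq; rewrite cmp_idl -cmpA.
    by rewrite tpair_fst pair_fst.
  by rewrite tpair_snd pair_snd.
rewrite -[h]cmp_idr -[k]cmp_idr -fmap_id -retr fmap_cmp !cmpA.
by rewrite !cmp_fmap_pair hk0 hk1.
Qed.

End Pairing.

(** * Addition of tangent vectors *)

Section Sums.
Context (X : cartesian_tangent_category).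
Local Notation T := (tan X).

Lemma tan0_nat (A B : X) (f : A ~> B) : tan0 A ;; fmap T f = f ;; tan0 B.
Proof. by rewrite /tan0 -(nt_nat (td_zero (tc_data X)) f). Qed.

Lemma tanp_nat (A B : X) (f : A ~> B) : fmap T f ;; tanp B = tanp A ;; f.
Proof. exact: (nt_nat (tp (tc_data X)) f). Qed.

Lemma tan0_p (A : X) : tan0 A ;; tanp A = idm A.
Proof. exact: td_zero_over. Qed.

Lemma tanc_nat (A B : X) (f : A ~> B) :
  fmap T (fmap T f) ;; tanc B = tanc A ;; fmap T (fmap T f).
Proof. exact: (nt_nat (td_flip (tc_data X)) f). Qed.

Lemma tanc_tanc (A : X) : tanc A ;; tanc A = idm _.
Proof. exact: (tx_flip_flip (tc_axioms X)). Qed.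

Lemma tan0_c (A : X) : tan0 (T A) ;; tanc A = fmap T (tan0 A).
Proof.
have H := bm_zero (tx_flip (tc_axioms X) A).
rewrite /= cmp_idl in H.
by rewrite /tan0 -H -cmpA [X in _ ;; X = _]tanc_tanc cmp_idr.
Qed.

Lemma tanc_p (A : X) : tanc A ;; tanp (T A) = fmap T (tanp A).
Proof. by have := bm_sq (tx_flip (tc_axioms X) A); rewrite /= cmp_idr. Qed.

(** The sum of two generalized tangent vectors over the same map to [M]. *)
Definition tsum (Z M : X) (f g : Z ~> T M) (fg : f ;; tanp M = g ;; tanp M) :
  Z ~> T M := @b_sum X (tbundle (tc_data X) M) Z f g fg.

Lemma fp_pair_ext (Z M : X) (f g f' g' : Z ~> T M)
    (fg : f ;; tanp M = g ;; tanp M) (fg' : f' ;; tanp M = g' ;; tanp M) :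
  f = f' -> g = g' ->
  fp_pair (tn_fp0 (tc_data X) 2 M) fg = fp_pair (tn_fp0 (tc_data X) 2 M) fg'.
Proof.
move=> ff gg; apply: (fp_uniq (tn_fp0 (tc_data X) 2 M)).
  by rewrite !fp_pair_base ff.
by move=> i; rewrite !fp_lift_proj ff gg.
Qed.

(** The sum does not depend on the proof that the summands share a base. *)
Lemma tsum_ext (Z M : X) (f g f' g' : Z ~> T M)
    (fg : f ;; tanp M = g ;; tanp M) (fg' : f' ;; tanp M = g' ;; tanp M) :
  f = f' -> g = g' -> tsum fg = tsum fg'.
Proof. by move=> ff gg; congr (_ ;; _); apply: fp_pair_ext. Qed.

Lemma cmp_compat (Y Z M : X) (h : Y ~> Z) (f g : Z ~> T M) :
  f ;; tanp M = g ;; tanp M -> h ;; f ;; tanp M = h ;; g ;; tanp M.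
Proof. by move=> fg; rewrite -!cmpA fg. Qed.

Lemma cmp_tsum (Y Z M : X) (h : Y ~> Z) (f g : Z ~> T M)
    (fg : f ;; tanp M = g ;; tanp M) :
  h ;; tsum fg = tsum (cmp_compat h fg).
Proof.
rewrite /tsum /b_sum cmpA; congr (_ ;; _).
apply: (fp_uniq (tn_fp0 (tc_data X) 2 M)).
  by rewrite -cmpA !fp_pair_base cmpA.
by move=> i; rewrite -cmpA !fp_lift_proj /fam2; case: ifP.
Qed.

Lemma fmap_compat (Z M N : X) (h : M ~> N) (f g : Z ~> T M) :
  f ;; tanp M = g ;; tanp M ->
  f ;; fmap T h ;; tanp N = g ;; fmap T h ;; tanp N.
Proof. by move=> fg; rewrite -!cmpA tanp_nat !cmpA fg. Qed.

Lemma tsum_fmap (Z M N : X) (h : M ~> N) (f g : Z ~> T M)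
    (fg : f ;; tanp M = g ;; tanp M) :
  tsum fg ;; fmap T h = tsum (fmap_compat h fg).
Proof.
rewrite /tsum /b_sum /= -cmpA -(nt_nat (td_add (tc_data X)) h) cmpA.
congr (_ ;; _); apply: (fp_uniq (tn_fp0 (tc_data X) 2 N)) => /=.
  by rewrite -cmpA /tn_map fp_lift_base cmpA !fp_pair_base -!cmpA tanp_nat.
move=> i; rewrite -cmpA /tn_map !fp_lift_proj cmpA fp_lift_proj.
by rewrite /fam2; case: ifP.
Qed.

Lemma tsum_comm (Z M : X) (f g : Z ~> T M) (fg : f ;; tanp M = g ;; tanp M) :
  tsum fg = tsum (esym fg).
Proof.
rewrite {1}/tsum /b_sum -(ab_comm (tx_bundle (tc_axioms X) M)).
set s := b_sum _.
have -> : s = tsum (b_same (tbundle (tc_data X) M) i1_2 i0_2) by [].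
by rewrite cmp_tsum; apply: tsum_ext; rewrite /= ?fp_pair0 ?fp_pair1.
Qed.

Lemma tsum_zerol (Z M : X) (f : Z ~> T M)
    (H : f ;; tanp M ;; tan0 M ;; tanp M = f ;; tanp M) :
  tsum H = f.
Proof.
rewrite -[RHS]cmp_idr -(ab_unit (tx_bundle (tc_axioms X) M)).
set s := b_sum _.
have -> : s = tsum (b_zero_compat (tbundle (tc_data X) M)) by [].
by rewrite cmp_tsum; apply: tsum_ext; rewrite /= ?cmp_idr ?cmpA.
Qed.

Lemma tsum_zeror (Z M : X) (f : Z ~> T M)
    (H : f ;; tanp M = f ;; tanp M ;; tan0 M ;; tanp M) :
  tsum H = f.
Proof. by rewrite tsum_comm tsum_zerol. Qed.

Lemma zero_base (Z M : X) (f : Z ~> T M) :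
  f ;; tanp M ;; tan0 M ;; tanp M = f ;; tanp M.
Proof. by rewrite -!cmpA tan0_p cmp_idr. Qed.

Lemma tpair_split_compat (Z A B : X) (a : Z ~> T A) (b : Z ~> T B) :
  tpair (a ;; tanp A ;; tan0 A) b ;; tanp _ =
  tpair a (b ;; tanp B ;; tan0 B) ;; tanp _.
Proof.
apply: (pr_uniq (ct_prodP A B)); rewrite -![tpair _ _ ;; _ ;; _]cmpA -!tanp_nat.
  by rewrite !cmpA !tpair_fst zero_base.
by rewrite !cmpA !tpair_snd zero_base.
Qed.

(** [<a, b> = <0, b> + <a, 0>]. *)
Lemma tpair_split (Z A B : X) (a : Z ~> T A) (b : Z ~> T B) :
  tpair a b = tsum (tpair_split_compat a b).
Proof.
apply: tpair_uniq; rewrite tsum_fmap.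
  rewrite tpair_fst -[LHS](tsum_zerol (zero_base a)).
  by apply: tsum_ext; rewrite tpair_fst.
rewrite tpair_snd -[LHS](tsum_zeror (esym (zero_base b))).
by apply: tsum_ext; rewrite tpair_snd.
Qed.

Lemma vf_sum_section (M : X) (V1 V2 : vector_field M) :
  vf_sum V1 V2 ;; tanp M = idm M.
Proof.
by rewrite /vf_sum -cmpA td_add_over fp_pair_base; apply: vf_section.
Qed.

Lemma vf_tangent_section (M : X) (V : vector_field M) :
  fmap T V ;; tanc M ;; tanp (T M) = idm (T M).
Proof. by rewrite -cmpA tanc_p -fmap_cmp vf_section fmap_id. Qed.

(** The tangent lift [T(V)c] of a vector field on [M] to one on [TM]. *)
Definition vf_tangent (M : X) (V : vector_field M) : vector_field (T M) :=
  VectorField (vf_tangent_section V).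

(** The sum [<V1, V2> +], as a vector field. *)
Definition vf_add (M : X) (V1 V2 : vector_field M) : vector_field M :=
  VectorField (vf_sum_section V1 V2).

End Sums.

(** * Solutions and flows *)

Section Flows.
Context (X : cartesian_tangent_category) (C : dynamical_system X).
Local Notation T := (tan X).
Local Notation c1 := (ds_vf C).
Local Notation c0 := (ds_init C).

(** The defining equation of a solution, at an arbitrary time and
    parameter. *)
Lemma solution_at (M : X) (V : vector_field M) (A : X) (g : A ~> M)
    (gamma : ct_prod (ds_obj C) A ~> M) (sol : is_solution V g gamma)
    (Z : X) (a : Z ~> ds_obj C) (b : Z ~> A) :
  tpair (a ;; c1) (b ;; tan0 A) ;; fmap T gamma = pair a b ;; gamma ;; V.
Proof.
case: sol => _ sol; rewrite -[RHS]cmpA -sol pmap_tan_prod !cmpA tpair_cmp.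
by rewrite !cmpA pair_fst pair_snd.
Qed.

(** Substituting [h] in the parameter of a solution for [g] gives a solution
    for [h ;; g]; thus a solution for [1_M] makes [V] complete. *)
Lemma solution_subst (M : X) (V : vector_field M) (A B : X) (g : A ~> M)
    (h : B ~> A) (gamma : ct_prod (ds_obj C) A ~> M) :
  is_solution V g gamma ->
  is_solution V (h ;; g) (pmap (idm (ds_obj C)) h ;; gamma).
Proof.
move=> sol; split.
  rewrite cmpA pair_pmap cmp_idr cmp_idl -(proj1 sol) cmpA pair_cmp.
  by rewrite cmpA bang_cmp cmp_idr.
rewrite pmap_tan_prod fmap_cmp cmpA cmp_fmap_pair !fmap_cmp !cmpA.
rewrite tpair_fst tpair_snd fmap_id cmp_idr -[_ ;; tan0 B ;; _]cmpA tan0_nat.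
by rewrite cmpA (solution_at sol) /pmap cmp_idr.
Qed.

(** A flow of [V2] preserves any vector field [V1] commuting with [V2]. *)
Lemma flow_preserves_commuting (hC : curve_object C) (M : X)
    (V1 V2 : vector_field M) (gamma : ct_prod (ds_obj C) M ~> M) :
  commute V1 V2 -> is_solution V2 (idm M) gamma ->
  pmap (tan0 (ds_obj C)) V1 ;; tan_prod (ds_obj C) M ;; fmap T gamma
  = gamma ;; V1.
Proof.
move=> comm sol; have [init deriv] := sol.
apply: (co_preinitial hC (V := vf_tangent V2) (g := V1)); split => /=.
(* Initial value and derivative of (0 x V1) T(gamma), then of gamma V1. *)
- rewrite pmap_tan_prod !cmpA tpair_cmp !cmpA pair_fst pair_snd cmp_idl.
  rewrite -[RHS]cmp_idr -fmap_id -init fmap_cmp cmpA cmp_fmap_pair.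
  rewrite fmap_id cmp_idr -[bang M ;; _ ;; _]cmpA -tan0_nat fmap_cmp !cmpA.
  (* Both sides contain a map M -> T1, and T1 is terminal. *)
  by rewrite (tm_uniq (ct_T_one X) (bang M ;; tan0 _) (V1 ;; fmap T (bang M))).
- (* Since gamma solves V2, this amounts to an equation between maps from C x M to
     T^2(C x M), which is checked on the two projections. *)
  rewrite !fmap_cmp !cmpA -[_ ;; fmap T gamma ;; fmap T V2]cmpA -fmap_cmp.
  rewrite -deriv !fmap_cmp !cmpA -[RHS]cmpA tanc_nat cmpA.
  apply: (congr1 (fun h => h ;; fmap T (fmap T gamma))).
  rewrite -![_ ;; fmap T (pmap _ _) ;; _]cmpA -!fmap_cmp !pmap_tan_prod.
  apply: tan2_prod_uniq; rewrite -[RHS]cmpA -tanc_nat !cmpA.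
    rewrite -![_ ;; fmap T (tpair _ _) ;; _]cmpA -!fmap_cmp !tpair_fst.
    rewrite !fmap_cmp !cmpA !tpair_fst -[_ ;; tan0 _ ;; _]cmpA tan0_nat.
    by rewrite -!cmpA tan0_c.
  rewrite -![_ ;; fmap T (tpair _ _) ;; _]cmpA -!fmap_cmp !tpair_snd.
  rewrite !fmap_cmp !cmpA !tpair_snd -[_ ;; tan0 _ ;; _]cmpA tan0_nat.
  rewrite -!cmpA -tan0_c !cmpA.
  by rewrite -[RHS]cmpA tanc_tanc cmp_idr.
- by rewrite cmpA init cmp_idl.
- by rewrite fmap_cmp cmpA deriv -!cmpA -comm !cmpA.
Qed.

(** The derivative [<pi_0 c1, gamma1 V1> T(gamma2)] is split as a sum by
    [tpair_split]; its summands are [gamma V1] and [gamma V2]. *)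
Lemma solution_sum (hC : curve_object C) (M : X) (V1 V2 : vector_field M)
    (gamma1 gamma2 : ct_prod (ds_obj C) M ~> M) :
  commute V1 V2 ->
  is_solution V1 (idm M) gamma1 -> is_solution V2 (idm M) gamma2 ->
  is_solution (vf_add V1 V2) (idm M)
    (pair (ct_fst (ds_obj C) M) gamma1 ;; gamma2).
Proof.
move=> comm sol1 sol2; split.
  rewrite cmpA pair_cmp pair_fst (proj1 sol1); exact: (proj1 sol2).
rewrite pmap_tan_prod fmap_cmp cmpA cmp_fmap_pair tpair_fst.
rewrite (solution_at sol1) pair_eta cmp_idl tpair_split tsum_fmap /=.
rewrite [RHS](cmp_tsum _ (vf_compat V1 V2)); apply: tsum_ext.
- rewrite -(cmpA _ c1) vf_section cmp_idr -[RHS]cmpA.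
  rewrite -(flow_preserves_commuting hC comm sol2) pmap_tan_prod.
  by rewrite !cmpA tpair_cmp !cmpA pair_fst pair_snd.
- rewrite -(cmpA gamma1 V1) vf_section cmp_idr.
  exact: (solution_at sol2).
Qed.

(** The composite through [C x C x M] is [<pi_0, gamma1>]. *)
Lemma flow_sum_expr (M : X) (gamma1 : ct_prod (ds_obj C) M ~> M) :
  pmap (diag (ds_obj C)) (idm M) ;; passoc (ds_obj C) (ds_obj C) M
    ;; pmap (idm (ds_obj C)) gamma1
  = pair (ct_fst (ds_obj C) M) gamma1.
Proof.
rewrite /passoc pair_cmp pair_pmap cmp_idr [pmap (diag _) _]/pmap pair_pmap.
rewrite cmpA pair_fst -!(cmpA _ (diag _)) /diag pair_fst pair_snd !cmp_idr.
by rewrite pair_eta cmp_idl.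
Qed.

End Flows.

Theorem proposition4p37 (X : cartesian_tangent_category)
    (C : dynamical_system X) (hC : curve_object C)
    (M : X) (V1 V2 : vector_field M)
    (hV1 : complete C V1) (hV2 : complete C V2)
    (gamma1 gamma2 : ct_prod (ds_obj C) M ~> M)
    (hgamma1 : is_flow V1 gamma1) (hgamma2 : is_flow V2 gamma2)
    (hcomm : commute V1 V2) :
  exists W : vector_field M,
    vf_map W = vf_sum V1 V2 /\
    complete C W /\
    is_flow W (pmap (diag (ds_obj C)) (idm M)
               ;; passoc (ds_obj C) (ds_obj C) M
               ;; pmap (idm (ds_obj C)) gamma1
               ;; gamma2).
Proof.
rewrite flow_sum_expr.
have sol := solution_sum hC hcomm (proj1 hgamma1) (proj1 hgamma2).
exists (vf_add V1 V2); split=> //; split.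
  move=> A g; eexists.
  by have := solution_subst g sol; rewrite cmp_idr; apply.
by split=> // gamma' sol'; apply: (co_preinitial hC sol sol').
Qed.
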